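(* Let $\mathbb{Z}^2=\{(x_1,x_2): x_1,x_2\in\mathbb{Z}\}\subset\mathbb{R}^2$ with the standard inner product. For every positive integer $m$ such that the shell $(\mathbb{Z}^2)_m=\{x\in\mathbb{Z}^2 : \langle x|x\rangle=m\}$ is nonempty, the set $(\mathbb{Z}^2)_m$ is not a spherical $5$-design.
   Context: A finite nonempty set $X$ lying on the sphere $S_r=\{x\in\mathbb{R}^n: \langle x|x\rangle=r^2\}$ (with $r>0$) is called a spherical $t$-design if $\frac{1}{|X|}\sum_{x\in X}f(x)=\frac{1}{|S_r|}\int_{S_r}f(x)\,d\sigma(x)$ for all polynomials $f$ in $n$ variables of degree at most $t$, where $d\sigma$ is the surface measure and $|S_r|$ the surface area (equivalently, the rescaled set $\frac{1}{r}X$ is a spherical $t$-design on the unit sphere in the sense of Delsarte–Goethals–Seidel). *)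

(* Defs.v *)
From HB Require Import structures.
From mathcomp Require Import all_boot all_order all_algebra.
From mathcomp Require Import all_classical all_reals all_analysis.
From mathcomp Require Import finmap.
From mathcomp Require mpoly.
Import (canonicals, coercions) mpoly.

Set Implicit Arguments.
Unset Strict Implicit.
Unset Printing Implicit Defensive.

Import Order.TTheory GRing.Theory Num.Theory.
Import numFieldNormedType.Exports.

Local Open Scope classical_set_scope.
Local Open Scope ring_scope.

Definition inner (R : realType) (n : nat) (x y : 'rV[R]_n) : R :=
  \sum_(i < n) x 0 i * y 0 i.

Definition sphere (R : realType) (n : nat) (r : R) : set 'rV[R]_n :=
  [set x : 'rV[R]_n | inner x x = r ^+ 2].

(* Line integral of f with respect to arc length along the curve c,
   parametrized by [a, b]. *)
Definition arc_integral (R : realType) (n : nat) (c : R -> 'rV[R]_n) (a b : R)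
    (f : 'rV[R]_n -> R) : R :=
  Rintegral lebesgue_measure `[a, b]%classic
    (fun s => f (c s) * Num.sqrt (\sum_(i < n) derive1 (fun u => c u 0 i) s ^+ 2)).

Definition circle_param (R : realType) (r s : R) : 'rV[R]_2 :=
  \row_(i < 2) (if i == 0 then r * cos s else r * sin s).

(* In dimension 2 the surface measure of S_r is arc length on the circle;
   for r > 0, circle_param r traverses S_r once as s runs over [0, 2 pi]. *)
Definition circle_integral (R : realType) (r : R) (f : 'rV[R]_2 -> R) : R :=
  arc_integral (circle_param r) 0 (2 * pi) f.

Definition circle_length (R : realType) (r : R) : R :=
  circle_integral r (fun=> 1).

Definition peval (R : realType) (n : nat) (p : mpoly.mpoly n R)
    (x : 'rV[R]_n) : R :=
  mpoly.meval (fun i => x 0 i) p.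

(* mpoly.msize is the total degree plus one (and 0 for the zero polynomial). *)
Definition spherical_design (R : realType) (t : nat) (X : set 'rV[R]_2) : Prop :=
  exists r : R,
    [/\ 0 < r, finite_set X, X !=set0, X `<=` sphere r &
      forall p : mpoly.mpoly 2 R, (mpoly.msize p <= t.+1)%N ->
        (#|` fset_set X |%:R)^-1 * (\sum_(x \in X) peval p x)
        = (circle_length r)^-1 * circle_integral r (peval p)].

Definition int_lattice (R : realType) (n : nat) : set 'rV[R]_n :=
  [set x : 'rV[R]_n | forall i : 'I_n, exists z : int, x 0 i = z%:~R].

Definition shell (R : realType) (n : nat) (L : set 'rV[R]_n) (m : nat) :
    set 'rV[R]_n :=
  [set x : 'rV[R]_n | L x /\ inner x x = m%:R].

(* Main.v *)
Require Import Defs.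
From mathcomp Require Import all_boot all_order all_algebra.
From mathcomp Require Import all_classical all_reals all_analysis.
From mathcomp Require Import finmap.
From mathcomp Require mpoly.
From mathcomp Require Import ring zify.
Import (canonicals, coercions) mpoly.

(* The polynomial Re (x + i y)^4 is harmonic, so its integral over a circle is 0,
   and a 5-design (even a 4-design) would make theta m, the sum of Re z^4 over
   the Gaussian integers z of norm m, vanish.  But theta is a Hecke eigenform:
   for p = N(w) an odd prime, the z of norm p m are the multiples of w or of its
   conjugate, whence theta (p m) = 2 Re(w^4) theta m - p^4 theta (m / p) by
   inclusion-exclusion, and 2 Re(w^4) is nonzero modulo p, so that
   theta (p^k m) = c theta m with p not dividing c when p does not divide m.
   Moreover theta (2 m) = - 4 theta m, and theta m = p^4 theta (m / p^2) when
   the prime p | m is not a norm.  By induction on m, theta m is never 0 on a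
   nonempty shell. *)

Set Implicit Arguments.
Unset Strict Implicit.
Unset Printing Implicit Defensive.

Import Order.TTheory GRing.Theory Num.Theory.
Import numFieldNormedType.Exports.

Local Open Scope classical_set_scope.
Local Open Scope ring_scope.

(** * Gaussian integers of given norm *)

(* Gaussian integers x + i y are encoded as pairs (x, y). *)
Definition gmul (z w : int * int) : int * int :=
  (z.1 * w.1 - z.2 * w.2, z.1 * w.2 + z.2 * w.1).

Definition gnorm (z : int * int) : int := z.1 ^+ 2 + z.2 ^+ 2.

Definition re_pow4 (z : int * int) : int :=
  z.1 ^+ 4 - 6 * z.1 ^+ 2 * z.2 ^+ 2 + z.2 ^+ 4.

Definition circ (m : int) : set (int * int) := [set z | gnorm z = m].

Definition theta (m : int) : int := \sum_(z \in circ m) re_pow4 z.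

Lemma gnormM z w : gnorm (gmul z w) = gnorm z * gnorm w.
Proof. by rewrite /gnorm /gmul /=; ring. Qed.

Lemma gmulI z : gnorm z != 0 -> injective (gmul z).
Proof.
case: z => a b; rewrite /gnorm /= => n0 [x y] [u v] [] e1 e2.
(* The identities are the two components of conj(z) (z w - z w'), with conj(z) z = [gnorm z]. *)
have key : (a ^+ 2 + b ^+ 2) * (x - u) = 0 /\ (a ^+ 2 + b ^+ 2) * (y - v) = 0.
  split.
    have -> : (a ^+ 2 + b ^+ 2) * (x - u) =
      a * ((a * x - b * y) - (a * u - b * v)) +
      b * ((a * y + b * x) - (a * v + b * u)) by ring.
    by rewrite e1 e2 !subrr !mulr0 addr0.
  have -> : (a ^+ 2 + b ^+ 2) * (y - v) =
    a * ((a * y + b * x) - (a * v + b * u)) -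
    b * ((a * x - b * y) - (a * u - b * v)) by ring.
  by rewrite e1 e2 !subrr !mulr0 addr0.
case: key => /eqP + /eqP; rewrite !mulf_eq0 !(negbTE n0) !subr_eq0 /=.
by move=> /eqP-> /eqP->.
Qed.

Lemma finite_circ m : finite_set (circ m).
Proof.
have fin : finite_set [set z : int | (`|z| < `|m|.+1)%N].
  apply: (@sub_finite_set _ _
    ((fun b : nat * bool => (-1) ^+ b.2 * (b.1)%:Z) @`
      (`I_(`|m|.+1) `*` setT))).
    move=> z /= zm.
    exists (`|z|%N, (z < 0)%R) => //=.
    by rewrite -intEsign.
  apply: finite_image; exact: finite_setX (finite_II _) finite_finset.
apply: sub_finite_set (finite_setX fin fin) => -[x y].
rewrite /circ /gnorm /= => e.
by split; nia.
Qed.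

(** Multiplication by [z] scales norms by [gnorm z] and is injective, so it reindexes the sum over
    the multiples of [z]. *)
Lemma sum_circ_gmul z m : gnorm z != 0 ->
  \sum_(w \in circ (gnorm z * m) `&` range (gmul z)) re_pow4 w
  = \sum_(w \in circ m) re_pow4 (gmul z w).
Proof.
move=> z0; apply: reindex_fsbig; split.
- by move=> w wm; split; [rewrite /circ /= gnormM wm | exists w].
- by move=> u v _ _; exact: gmulI.
- move=> u [um [w _ uE]]; move: um; rewrite -uE /circ /= gnormM => /(mulfI z0) wm.
  by exists w.
Qed.

Lemma theta_gmul z m : gnorm z != 0 ->
  circ (gnorm z * m) `<=` range (gmul z) ->
  theta (gnorm z * m) = \sum_(w \in circ m) re_pow4 (gmul z w).
Proof.
move=> z0 zr; rewrite -sum_circ_gmul //; apply: eq_fsbigl.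
by apply/seteqP; split => w /= => [wm|[]//]; split => //; exact: zr.
Qed.

Lemma re_pow4_scale (k : int) w : re_pow4 (gmul (k, 0) w) = k ^+ 4 * re_pow4 w.
Proof. by rewrite /re_pow4 /=; ring. Qed.

(** For v = a + i b, the number v^4 + conj(v)^4 is real and so factors out of the real part. *)
Lemma re_pow4_gmul_conj a b w :
  re_pow4 (gmul (a, b) w) + re_pow4 (gmul (a, - b) w)
  = 2 * re_pow4 (a, b) * re_pow4 w.
Proof. by rewrite /re_pow4 /=; ring. Qed.

(** * Norm 1 and the ramified prime 2 *)

Lemma theta1_neq0 : theta 1 != 0.
Proof.
have pos z : circ 1 z -> re_pow4 z = 1.
  case: z => x y; rewrite /circ /gnorm /re_pow4 /= => e.
  (* Norm 1 leaves only the four units, each with fourth power 1. *)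
  have xy : x * y = 0 by nia.
  have -> : x ^+ 4 - 6 * x ^+ 2 * y ^+ 2 + y ^+ 4 =
    (x ^+ 2 + y ^+ 2) ^+ 2 - 8 * (x * y) ^+ 2 by ring.
  by rewrite e xy.
apply/eqP => /(pfsumr_eq0 (finite_circ 1)) h.
have c1 : circ 1 (1, 0) by [].
by have := h (fun z zc => ltac:(rewrite (pos z zc); exact: ler01)) _ c1.
Qed.

Lemma circ_double_range m : circ (2 * m) `<=` range (gmul (1, 1)).
Proof.
move=> [x y]; rewrite /circ /gnorm /= => e.
(* This is (x + i y) / (1 + i); exactness follows as (x + y)^2 is even. *)
exists (((x + y) %/ 2)%Z, ((y - x) %/ 2)%Z) => //.
have : (2 %| x + y)%Z.
  have : (2 %| (x + y) ^+ 2)%Z.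
    have -> : (x + y) ^+ 2 = 2 * (m + x * y) by rewrite mulrDr -e; ring.
    exact: dvdz_mulr.
  by rewrite !dvdzE abszX Euclid_dvdX // andbT.
move=> d; rewrite /gmul /=; congr pair; lia.
Qed.

(** Every point is a multiple of 1 + i, and (1 + i)^4 = - 4. *)
Lemma theta_double m : theta (2 * m) = - 4 * theta m.
Proof.
rewrite (_ : 2 = gnorm (1, 1)) // theta_gmul //; last exact: circ_double_range.
rewrite /theta mulr_fsumr; apply: eq_fsbigr => -[x y] _.
by rewrite /re_pow4 /=; ring.
Qed.

(** * Primes that are not norms *)

Lemma prime_dvdzM (p : nat) (x y : int) : prime p ->
  (p%:Z %| x * y)%Z = (p%:Z %| x)%Z || (p%:Z %| y)%Z.
Proof. by move=> pp; rewrite !dvdzE abszM Euclid_dvdM. Qed.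

Lemma prime_dvdzX (p n : nat) (x : int) : prime p ->
  (p%:Z %| x ^+ n.+1)%Z = (p%:Z %| x)%Z.
Proof. by move=> pp; rewrite !dvdzE abszX Euclid_dvdX // andbT. Qed.

Lemma sqr_sub_le (k a b : nat) : (a <= k)%N -> (b <= k)%N ->
  (a%:Z - b%:Z) ^+ 2 <= (k * k)%N%:Z.
Proof.
move=> ak bk; have h : `|a%:Z - b%:Z| <= k%:Z by lia.
by rewrite -real_normK ?num_real // PoszM expr2; apply: ler_pM.
Qed.

(* Thue's argument: among the (k+1)^2 > p values x u + y v with
   0 <= u, v <= k = floor (sqrt p), two agree modulo p. *)
Lemma prime_sum_two_squares (p : nat) (x y : int) : prime p ->
    (p%:Z %| x ^+ 2 + y ^+ 2)%Z -> ~~ (p%:Z %| x)%Z ->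
  exists z, gnorm z = p%:Z.
Proof.
move=> pp pxy px; have p_gt0 := prime_gt0 pp.
have [k kp pk] : exists2 k, (k * k <= p)%N & (p < k.+1 * k.+1)%N.
  elim: p {pp pxy px p_gt0} => [|n [k kn nk]]; first by exists 0%N.
  have [h|h] := ltnP n.+1 (k.+1 * k.+1); first by exists k => //; lia.
  by exists k.+1 => //; lia.
(* The integer residue already lies in [0, p); the outer reduction serves only to land in ['I_p]. *)
pose F (u : 'I_k.+1 * 'I_k.+1) : 'I_p :=
  Ordinal (ltn_pmod (absz ((x * (u.1 : nat)%:Z + y * (u.2 : nat)%:Z) %% p%:Z)%Z)
    p_gt0).
have /injectivePn [[u1 u2] [[v1 v2] uv Fuv]] : ~~ injectiveb F.
  apply/negP => /injectiveP /leq_card.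
  by rewrite card_prod !card_ord leqNgt pk.
set du : int := (u1 : nat)%:Z - (v1 : nat)%:Z.
set dv : int := (u2 : nat)%:Z - (v2 : nat)%:Z.
have pd : (p%:Z %| x * du + y * dv)%Z.
  have -> : x * du + y * dv = (x * (u1 : nat)%:Z + y * (u2 : nat)%:Z)
    - (x * (v1 : nat)%:Z + y * (v2 : nat)%:Z) by rewrite /du /dv; ring.
  move/(congr1 val): Fuv => /=.
  have pz : p%:Z != 0 by lia.
  move: (x * (u1 : nat)%:Z + _) (x * (v1 : nat)%:Z + _) => a b.
  have := modz_ge0 a pz; have := modz_ge0 b pz.
  have := ltz_pmod a (_ : 0 < p%:Z); have := ltz_pmod b (_ : 0 < p%:Z).
  rewrite !ltz_nat p_gt0 => /(_ isT) hb /(_ isT) ha hb0 ha0.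
  rewrite !modn_small; [|lia|lia] => e.
  by rewrite -eqz_mod_dvd; apply/eqP; lia.
have pn : (p%:Z %| du ^+ 2 + dv ^+ 2)%Z.
  have : (p%:Z %| x ^+ 2 * (du ^+ 2 + dv ^+ 2))%Z.
    have -> : x ^+ 2 * (du ^+ 2 + dv ^+ 2) =
      (x * du + y * dv) * (x * du - y * dv) + (x ^+ 2 + y ^+ 2) * dv ^+ 2.
      by ring.
    by apply: rpredD; apply: dvdz_mulr.
  by rewrite prime_dvdzM // prime_dvdzX // (negbTE px).
have /dvdzP[q qE] := pn.
have := ltn_ord u1; have := ltn_ord u2; have := ltn_ord v1; have := ltn_ord v2.
rewrite !ltnS => lv2 lv1 lu2 lu1.
have bu : du ^+ 2 <= (k * k)%N%:Z by exact: sqr_sub_le.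
have bv : dv ^+ 2 <= (k * k)%N%:Z by exact: sqr_sub_le.
have pos : 0 < du ^+ 2 + dv ^+ 2.
  rewrite lt_neqAle addr_ge0 ?sqr_ge0 // andbT eq_sym.
  rewrite paddr_eq0 ?sqr_ge0 // !sqrf_eq0.
  apply: contra uv; rewrite /du /dv !subr_eq0 !eqz_nat => /andP[/eqP e1 /eqP e2].
  by apply/eqP; congr pair; apply: val_inj.
(* Away from equality k^2 < p, so 0 < du^2 + dv^2 <= 2 k^2 < 2 p, and the only multiple of p in that
   range is p. *)
have [kpE|kpE] := eqVneq (k * k)%N p.
  by exists (k%:Z, 0); rewrite /gnorm /= expr0n addr0 expr2 -PoszM kpE.
exists (du, dv); rewrite /gnorm /= qE.
have -> : q = 1; last by rewrite mul1r.
clear -pk kp pos bu bv qE kpE p_gt0.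
by nia.
Qed.

(** A coordinate prime to p would make p a norm by Thue's argument. *)
Lemma inert_dvdz (p : nat) z : prime p -> ~ (exists w, gnorm w = p%:Z) ->
  (p%:Z %| gnorm z)%Z -> (p%:Z %| z.1)%Z /\ (p%:Z %| z.2)%Z.
Proof.
case: z => x y pp np; rewrite /gnorm /= => pd; split.
  by apply: contra_notT np; exact: prime_sum_two_squares pd.
apply: contra_notT np; apply: (@prime_sum_two_squares p y x) => //.
by rewrite addrC.
Qed.

Lemma dvdz_range_scale (p : nat) z :
  (p%:Z %| z.1)%Z -> (p%:Z %| z.2)%Z -> range (gmul (p%:Z, 0)) z.
Proof.
case: z => x y /= /dvdzP[a ->] /dvdzP[b ->].
by exists (a, b) => //; rewrite /gmul /=; congr pair; ring.
Qed.

Lemma theta_scale (p : nat) m : (0 < p)%N ->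
  \sum_(z \in circ (p%:Z ^+ 2 * m) `&` range (gmul (p%:Z, 0))) re_pow4 z
  = p%:Z ^+ 4 * theta m.
Proof.
move=> p0; have e : p%:Z ^+ 2 = gnorm (p%:Z, 0) by rewrite /gnorm expr0n addr0.
rewrite e sum_circ_gmul -?e ?expf_neq0 //; last by lia.
rewrite /theta mulr_fsumr; apply: eq_fsbigr => w _.
exact: re_pow4_scale.
Qed.

Lemma inert_circ (p : nat) m : prime p -> ~ (exists w, gnorm w = p%:Z) ->
  circ (p%:Z * m) `<=` range (gmul (p%:Z, 0)).
Proof.
move=> pp np z zm; have [] := @inert_dvdz p z pp np.
  by rewrite zm dvdz_mulr.
exact: dvdz_range_scale.
Qed.

(** * Odd primes that are norms *)

Section Split.
Variables (p : nat) (a b : int).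
Hypotheses (pp : prime p) (p_odd : odd p) (abp : a ^+ 2 + b ^+ 2 = p%:Z).

Let p_neq0 : p%:Z != 0. Proof. by have := prime_gt0 pp; lia. Qed.
Let norm1 : gnorm (a, b) = p%:Z. Proof. exact: abp. Qed.
Let norm2 : gnorm (a, - b) = p%:Z. Proof. by rewrite /gnorm /= sqrrN. Qed.

Let pNa : ~~ (p%:Z %| a)%Z.
Proof.
apply/negP => pa; have pb : (p%:Z %| b)%Z.
  rewrite -(@prime_dvdzX p 1) //.
  have -> : b ^+ 2 = p%:Z - a * a by rewrite -abp; ring.
  by rewrite rpredB // dvdz_mulr.
case/dvdzP: pa => u ua; case/dvdzP: pb => v vb.
have : p%:Z * (p%:Z * (u ^+ 2 + v ^+ 2)) = p%:Z * 1.
  by rewrite mulr1 -[RHS]abp ua vb; ring.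
move/(mulfI p_neq0) => e.
have : (p%:Z %| p%:Z * (u ^+ 2 + v ^+ 2))%Z by rewrite dvdz_mulr.
by rewrite e dvdzE /= dvdn1 => /eqP p1; move: (pp); rewrite p1.
Qed.

Let pNb : ~~ (p%:Z %| b)%Z.
Proof.
apply: contra pNa => pb; rewrite -(@prime_dvdzX p 1) //.
have -> : a ^+ 2 = p%:Z - b * b by rewrite -abp; ring.
by rewrite rpredB // dvdz_mulr.
Qed.

Let pN2 : ~~ (p%:Z %| 2)%Z.
Proof.
rewrite dvdzE /=; apply/negP => /(dvdn_leq (isT : 0 < 2)%N) p2.
by have := prime_gt1 pp; have := p_odd; case: (p) p2 => [|[|[|]]].
Qed.

(** Taking c = b or c = - b covers w = a + i b and its conjugate. The components of (x + i y) (a - i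
    c) are x a + y c and y a - x c; their squares sum to a multiple of p, so p divides both, and
    division by p = a^2 + c^2 gives the quotient. *)
Lemma split_range (c x y : int) : c ^+ 2 = b ^+ 2 ->
    (p%:Z %| x * a + y * c)%Z -> (p%:Z %| x ^+ 2 + y ^+ 2)%Z ->
  range (gmul (a, c)) (x, y).
Proof.
move=> cb d1 dn; have acp : a ^+ 2 + c ^+ 2 = p%:Z by rewrite cb.
have d2 : (p%:Z %| y * a - x * c)%Z.
  rewrite -(@prime_dvdzX p 1) //.
  have -> : (y * a - x * c) ^+ 2 =
    (x ^+ 2 + y ^+ 2) * (a ^+ 2 + c ^+ 2) - (x * a + y * c) * (x * a + y * c).
    by ring.
  by rewrite rpredB // dvdz_mulr.
case/dvdzP: d1 => u uE; case/dvdzP: d2 => v vE.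
exists (u, v) => //; rewrite /gmul /=; congr pair; apply: (mulIf p_neq0).
  have -> : (a * u - c * v) * p%:Z = a * (u * p%:Z) - c * (v * p%:Z) by ring.
  by rewrite -uE -vE -acp; ring.
have -> : (a * v + c * u) * p%:Z = a * (v * p%:Z) + c * (u * p%:Z) by ring.
by rewrite -uE -vE -acp; ring.
Qed.

Lemma range_split (c x y : int) : c ^+ 2 = b ^+ 2 ->
  range (gmul (a, c)) (x, y) -> (p%:Z %| x * a + y * c)%Z.
Proof.
move=> cb [[u v] _ [<- <-]].
have -> : (a * u - c * v) * a + (a * v + c * u) * c = (a ^+ 2 + c ^+ 2) * u.
  by ring.
by rewrite cb abp dvdz_mulr.
Qed.

(** The divisibility criteria for w and its conjugate have a product divisible by p, so one of them
    holds. *)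
Lemma split_cover m z : circ (p%:Z * m) z ->
  range (gmul (a, b)) z \/ range (gmul (a, - b)) z.
Proof.
case: z => x y; rewrite /circ /gnorm /= => e.
have dn : (p%:Z %| x ^+ 2 + y ^+ 2)%Z by rewrite e dvdz_mulr.
have : (p%:Z %| (x * a + y * b) * (x * a + y * - b))%Z.
  have -> : (x * a + y * b) * (x * a + y * - b) =
    (x ^+ 2 + y ^+ 2) * a ^+ 2 - (a ^+ 2 + b ^+ 2) * y ^+ 2 by ring.
  by rewrite abp rpredB // dvdz_mulr.
rewrite prime_dvdzM // => /orP[] d; [left|right]; apply: split_range => //.
exact: sqrrN.
Qed.

(** Adding and subtracting the two criteria gives p | 2 x a and p | 2 y b; conversely p = w
    conj(w). *)
Lemma split_both z :
  (range (gmul (a, b)) `&` range (gmul (a, - b))) z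
  <-> range (gmul (p%:Z, 0)) z.
Proof.
case: z => x y; split => [[/range_split-/(_ erefl) d1 /range_split-/(_ (sqrrN _)) d2]|].
  apply: dvdz_range_scale => /=.
    have : (p%:Z %| 2 * (x * a))%Z.
      have -> : 2 * (x * a) = (x * a + y * b) + (x * a + y * - b) by ring.
      exact: rpredD.
    by rewrite !prime_dvdzM // (negbTE pN2) (negbTE pNa) orbF.
  have : (p%:Z %| 2 * (y * b))%Z.
    have -> : 2 * (y * b) = (x * a + y * b) - (x * a + y * - b) by ring.
    exact: rpredB.
  by rewrite !prime_dvdzM // (negbTE pN2) (negbTE pNb) orbF.
move=> [[u v] _ [<- <-]]; split.
  exists (gmul (a, - b) (u, v)) => //; rewrite /gmul /= -abp.
  by congr pair; ring.
exists (gmul (a, b) (u, v)) => //; rewrite /gmul /= -abp.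
by congr pair; ring.
Qed.

(** Inclusion-exclusion over the multiples of w and of conj(w). The overlap stays a sum, since p
    need not divide m. *)
Lemma theta_split m :
  theta (p%:Z * m) = 2 * re_pow4 (a, b) * theta m -
    \sum_(z \in circ (p%:Z * m) `&` range (gmul (p%:Z, 0))) re_pow4 z.
Proof.
set A := range (gmul (a, b)); set B := range (gmul (a, - b)).
set C := circ (p%:Z * m); have fC : finite_set C by exact: finite_circ.
have eA : \sum_(z \in C `&` A) re_pow4 z
    = \sum_(w \in circ m) re_pow4 (gmul (a, b) w).
  by rewrite /C -norm1 sum_circ_gmul // norm1.
have eB : \sum_(z \in C `&` B) re_pow4 z
    = \sum_(w \in circ m) re_pow4 (gmul (a, - b) w).
  by rewrite /C -norm2 sum_circ_gmul // norm2.
have -> : theta (p%:Z * m) =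
    \sum_(z \in C `&` A) re_pow4 z + \sum_(z \in C `&` B) re_pow4 z
    - \sum_(z \in C `&` (A `&` B)) re_pow4 z.
  rewrite /theta -/C (fsbigID A) //=.
  rewrite [X in _ + X - _](fsbigID A) /=; last exact: finite_setIl.
  rewrite -[C `&` B `&` A]setIA [B `&` A]setIC.
  (* The triple intersection cancels; outside [A], all of [C] lies in [B]. *)
  rewrite [X in _ = _ + X - _]addrC addrA addrK; congr (_ + _).
  apply: eq_fsbigl; apply/seteqP; split => [z [zC zA]|z [[]]] //.
  by split => //; split => //; case: (split_cover zC).
rewrite eA eB -fsbig_split //=; last exact: finite_circ.
congr (_ - _).
  rewrite /theta mulr_fsumr; apply: eq_fsbigr => w _.
  exact: re_pow4_gmul_conj.
apply: eq_fsbigl; congr (_ `&` _); apply/seteqP.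
by split => z /split_both.
Qed.

(* a ^ 4 - 6 a ^ 2 b ^ 2 + b ^ 4 is congruent to - 8 a ^ 2 b ^ 2 modulo p. *)
Lemma split_eigenvalue : ~~ (p%:Z %| 2 * re_pow4 (a, b))%Z.
Proof.
rewrite prime_dvdzM // negb_or pN2 /=.
have -> : re_pow4 (a, b) = p%:Z * p%:Z - 2 * (2 * (2 * (a * (a * (b * b))))).
  by rewrite -abp /re_pow4 /=; ring.
rewrite rpredBl; last exact: dvdz_mulr.
by rewrite !prime_dvdzM // !negb_or pN2 pNa pNb.
Qed.

(** The coefficients satisfy c_(k+2) = t c_(k+1) - p^4 c_k, which is t c_(k+1) modulo p. *)
Lemma theta_split_pow (m : int) (k : nat) : ~~ (p%:Z %| m)%Z ->
  exists2 c, ~~ (p%:Z %| c)%Z & theta (p%:Z ^+ k * m) = c * theta m.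
Proof.
move=> pm; set t := 2 * re_pow4 (a, b).
have p1 : ~~ (p%:Z %| 1)%Z.
  by rewrite dvdzE /= dvdn1; have := prime_gt1 pp; case: (p) => [|[]].
(* The recurrence has order two, so the induction carries two consecutive exponents. *)
suff [c [d [pc pd ec ed]]] : exists c d, [/\ ~~ (p%:Z %| c)%Z,
    ~~ (p%:Z %| d)%Z, theta (p%:Z ^+ k * m) = c * theta m &
    theta (p%:Z ^+ k.+1 * m) = d * theta m] by exists c.
elim: k => [|k [c [d [pc pd ec ed]]]].
  exists 1, t; split => //; first exact: split_eigenvalue.
    by rewrite expr0 !mul1r.
  (* The overlap is empty: a multiple of p has norm divisible by p^2, unlike p m. *)
  rewrite expr1 theta_split (_ : _ `&` _ = set0) ?fsbig_set0 ?subr0 //.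
  apply/seteqP; split => // z [zm [w _ wz]]; move: zm.
  rewrite /circ /= -wz gnormM /gnorm /= expr0n addr0 expr2 -mulrA.
  by move/(mulfI p_neq0) => e; rewrite -e dvdz_mulr in pm.
exists d, (t * d - p%:Z ^+ 4 * c); split => //.
  rewrite rpredBr; last by rewrite exprS -mulrA dvdz_mulr.
  by rewrite prime_dvdzM // negb_or split_eigenvalue.
rewrite exprS -mulrA theta_split ed.
rewrite (_ : p%:Z * (p%:Z ^+ k.+1 * m) = p%:Z ^+ 2 * (p%:Z ^+ k * m)).
  by rewrite theta_scale ?prime_gt0 // ec /t; ring.
by rewrite exprS; ring.
Qed.

Lemma split_nonempty m k : circ (p%:Z ^+ k * m) !=set0 -> circ m !=set0.
Proof.
elim: k => [|k IH]; first by rewrite expr0 mul1r.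
rewrite exprS -mulrA => -[z zm]; apply: IH.
case: (split_cover zm) => -[w _ wz]; exists w; apply: (mulfI p_neq0).
  by rewrite -[RHS]zm -wz gnormM norm1.
by rewrite -[RHS]zm -wz gnormM norm2.
Qed.

End Split.

(** * Nonvanishing by induction on the norm *)

Lemma theta_neq0 (m : nat) : (0 < m)%N -> circ m%:Z !=set0 -> theta m%:Z != 0.
Proof.
elim/ltn_ind: m => m IH m_gt0 ne.
have [m1|m1] := leqP m 1.
  have -> : m = 1%N by lia.
  exact: theta1_neq0.
pose p := pdiv m; have pp : prime p := pdiv_prime m1.
have p_gt1 := prime_gt1 pp.
have [n mE] : exists n, m = (p * n)%N.
  by have /dvdnP[n ->] := pdiv_dvd m; exists n; rewrite mulnC.
case: (pselect (exists w, gnorm w = p%:Z)) => [[[a b] abp]|np]; last first.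
  have sub : circ m%:Z `<=` range (gmul (p%:Z, 0)).
    by rewrite mE PoszM; exact: inert_circ.
  (* A point of the circle is p w, so m = p^2 q with q = [gnorm w], and w shows that the smaller
     circle is nonempty. *)
  have [z zm] := ne; have [w _ wz] := sub z zm.
  have e : m%:Z = p%:Z ^+ 2 * gnorm w.
    by rewrite -zm -wz gnormM /gnorm /= expr0n addr0.
  have w0 : 0 <= gnorm w by rewrite addr_ge0 ?sqr_ge0.
  move: e; rewrite -(gez0_abs w0); set q := absz _ => e.
  have q0 : (0 < q)%N by move: e; case: (posnP q) => // ->; lia.
  have qm : (q < m)%N by nia.
  have : theta m%:Z = p%:Z ^+ 4 * theta q%:Z.
    rewrite -theta_scale ?(ltnW p_gt1) // -e; apply: eq_fsbigl.
    by apply/seteqP; split => // u um; split => //; exact: sub.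
  move=> ->; rewrite mulf_neq0 ?expf_neq0 //; first by lia.
  by apply: IH => //; exists w; rewrite /circ /= gez0_abs.
have [p2|p2] := eqVneq p 2%N.
  have mE2 : m%:Z = 2 * n%:Z by rewrite mE p2 PoszM.
  rewrite mE2 theta_double mulf_neq0 //.
  apply: IH; [lia|lia|].
  have [z zm] := ne.
  have [] : range (gmul (1, 1)) z by apply: (@circ_double_range n%:Z); rewrite -mE2.
  move=> w _ wz; exists w; rewrite /circ /=; move: zm.
  by rewrite /circ /= -wz gnormM mE2 => /(mulfI _); apply.
have p_odd : odd p by case: (even_prime pp) p2 => // ->.
(* The full power of p is removed at once, since [theta_split_pow] requires a cofactor prime to
   p. *)
have [m' pm' mE'] := pfactor_coprime pp m_gt0.
have m'E : m%:Z = p%:Z ^+ logn p m * m'%:Z.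
  by rewrite {1}mE' PoszM mulrC -[(p ^ _)%N%:Z]natz natrX natz.
have pm'z : ~~ (p%:Z %| m'%:Z)%Z by rewrite dvdzE /= -prime_coprime.
have [c pc] := theta_split_pow pp p_odd abp (logn p m) pm'z.
rewrite -m'E => ->; rewrite mulf_neq0 //.
  by apply: contraNneq pc => ->; rewrite dvdz0.
have lp : (0 < logn p m)%N by rewrite logn_gt0 mem_primes pp m_gt0 pdiv_dvd.
apply: IH.
- by rewrite mE' ltn_Pmulr ?(ltn_exp2l 0) //; lia.
- by lia.
- by apply: (split_nonempty pp p_odd abp (k := logn p m)); rewrite -m'E.
Qed.

(** * The quartic harmonic and its circle integral *)

Definition harmonic4 (R : realType) : mpoly.mpoly 2 R :=
  let X i := mpoly.mpolyX R (mpoly.mnm1 i) in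
  X 0 ^+ 4 - 6%:R *: (X 0 ^+ 2 * X 1 ^+ 2) + X 1 ^+ 4.

Lemma msize_harmonic4 (R : realType) : (mpoly.msize (harmonic4 R) <= 6)%N.
Proof.
rewrite /harmonic4 !mpoly.mpolyXn -mpoly.mpolyXD.
apply: leq_trans (mpoly.msizeD_le _ _) _; rewrite geq_max; apply/andP; split.
  apply: leq_trans (mpoly.msizeD_le _ _) _; rewrite geq_max mpoly.msizeN.
  rewrite mpoly.msizeX mpoly.mdegMn mpoly.mdeg1 /=.
  apply: leq_trans (mpoly.msizeZ_le _ _) _.
  by rewrite mpoly.msizeX mpoly.mdegD !mpoly.mdegMn !mpoly.mdeg1.
by rewrite mpoly.msizeX mpoly.mdegMn mpoly.mdeg1.
Qed.

Lemma peval_harmonic4 (R : realType) (x : 'rV[R]_2) :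
  peval (harmonic4 R) x =
  x 0 0 ^+ 4 - 6 * (x 0 0 ^+ 2 * x 0 1 ^+ 2) + x 0 1 ^+ 4.
Proof.
rewrite /peval /harmonic4 mpoly.mevalD mpoly.mevalB mpoly.mevalZ.
by rewrite !rmorphXn /= mpoly.mevalM !rmorphXn /= !mpoly.mevalXU.
Qed.

Lemma circle_speed (R : realType) (r s : R) : 0 < r ->
  Num.sqrt (\sum_(i < 2) derive1 (fun u => circle_param r u 0 i) s ^+ 2) = r.
Proof.
move=> r0; rewrite !big_ord_recl big_ord0 addr0.
rewrite (_ : (fun u => _) = (fun u => r * cos u)); last first.
  by apply/funext => u; rewrite mxE.
rewrite (_ : (fun u => circle_param r u 0 _) = (fun u => r * sin u)); last first.
  by apply/funext => u; rewrite mxE.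
have d1 : is_derive s 1 (fun u => r * cos u) (r * - sin s).
  by apply: is_deriveZ.
have d2 : is_derive s 1 (fun u => r * sin u) (r * cos s).
  by apply: is_deriveZ.
rewrite !derive1E (derive_val (is_derive := d1)) (derive_val (is_derive := d2)).
rewrite (_ : _ + _ = r ^+ 2) ?sqrtr_sqr ?gtr0_norm //.
by rewrite -[RHS]mulr1 -(cos2Dsin2 s); ring.
Qed.

Lemma circle_integral_harmonic4 (R : realType) (r : R) : 0 < r ->
  circle_integral r (peval (harmonic4 R)) = 0.
Proof.
move=> r0; rewrite /circle_integral /arc_integral.
(* Here f = r^5 cos 4s, with one factor r from the speed, and F = r^5 (sin 4s) / 4 is its
   antiderivative, zero at both endpoints. *)
pose f (s : R) := r ^+ 5 * (cos s ^+ 4 - 6 * (cos s ^+ 2 * sin s ^+ 2) + sin s ^+ 4).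
pose F (s : R) := r ^+ 5 * ((cos s * sin s) * (cos s ^+ 2 - sin s ^+ 2)).
have dF (s : R) : is_derive s 1 F (f s).
  apply: is_derive_eq.
  rewrite /f /GRing.scale /=; ring.
transitivity (Rintegral lebesgue_measure `[0, 2 * pi]%classic f).
  apply: eq_Rintegral => s _; rewrite circle_speed // peval_harmonic4 !mxE /=.
  by rewrite /f; ring.
have cF : continuous F.
  by move=> s; apply/differentiable_continuous/derivable1_diffP; case: (dF s).
have cf : continuous f.
  move=> s; apply: differentiable_continuous; apply/derivable1_diffP.
  by rewrite /f; apply: ex_derive.
have pi2 : 0 < 2 * pi :> R by rewrite mulr_gt0 ?pi_gt0.
rewrite /Rintegral (@continuous_FTC2 _ _ F) //.
- rewrite /F sin0 !mulr0 !mul0r mulr0.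
  by rewrite mulr_natl sin2pi !mulr0 !mul0r mulr0 sube0.
- by apply: continuous_subspaceT.
- split.
  + by move=> s _; case: (dF s).
  + by apply: cvg_at_right_filter; exact: cF.
  + by apply: cvg_at_left_filter; exact: cF.
- by move=> s _; rewrite derive1E; case: (dF s).
Qed.

(** * From Gaussian integers to the shell *)

Definition lattice_point (R : realType) (z : int * int) : 'rV[R]_2 :=
  \row_(i < 2) (if i == 0 then z.1%:~R else z.2%:~R).

Lemma lattice_point_bij (R : realType) (m : nat) :
  set_bij (circ m%:Z) (shell (@int_lattice R 2) m) (@lattice_point R).
Proof.
have innerE z : inner (lattice_point R z) (lattice_point R z) = (gnorm z)%:~R.
  rewrite /inner !big_ord_recl big_ord0 addr0 !mxE /= /gnorm.
  by rewrite rmorphD !rmorphXn /= !expr2.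
split.
- move=> z zm; split; last by rewrite innerE zm.
  by move=> i; rewrite mxE; case: ifP => _; [exists z.1 | exists z.2].
- move=> [x y] [u v] _ _ /rowP e.
  have := e 0; have := e 1; rewrite !mxE /= => /intr_inj-> /intr_inj->.
  by [].
- move=> x [xL xm]; have [a ea] := xL 0; have [b eb] := xL 1.
  have xE : lattice_point R (a, b) = x.
    apply/rowP => i; rewrite mxE; case: ifP => [/eqP->//|i0].
    suff -> : i = 1 by [].
    by apply/val_inj; case: i i0 => [[|[|]]].
  exists (a, b) => //; apply: (@intr_inj R).
  by rewrite -innerE xE xm.
Qed.

Lemma sum_shell_harmonic4 (R : realType) (m : nat) :
  \sum_(x \in shell (@int_lattice R 2) m) peval (harmonic4 R) x
  = (theta m%:Z)%:~R.
Proof.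
rewrite (reindex_fsbig (@lattice_point R) (circ m%:Z)); last exact: lattice_point_bij.
rewrite /theta.
rewrite !fsbig_finite ?rmorph_sum; [|exact: finite_circ..].
apply: eq_bigr => z _; rewrite peval_harmonic4 !mxE /= /re_pow4.
by rewrite !(rmorphD, rmorphN, rmorphM, rmorphXn) /= mulrA.
Qed.

Theorem theorem1p2 (R : realType) (m : nat) (hm : (0 < m)%N)
    (hne : shell (@int_lattice R 2) m !=set0) :
  ~ spherical_design 5 (shell (@int_lattice R 2) m).
Proof.
move=> [r [r0 fin _ _ /(_ (harmonic4 R) (msize_harmonic4 R))]].
rewrite circle_integral_harmonic4 // mulr0 sum_shell_harmonic4 => /eqP.
rewrite mulf_eq0 invr_eq0 pnatr_eq0 cardfs_eq0 intr_eq0 => /orP[/eqP e|].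
  have [x xm] := hne.
  by have := in_fset_set fin x; rewrite e in_fset0 (mem_set xm).
apply/negP; apply: theta_neq0 => //.
have [x xm] := hne; have [_ _ /(_ x xm)[z zm _]] := lattice_point_bij R m.
by exists z.
Qed.
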